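(* Let $D\geq 2$ be an integer and let $B=(b_{ij})_{0\leq i,j\leq D}$ be a real nonnegative tridiagonal matrix with positive superdiagonal and subdiagonal entries. Write $\alpha_i=b_{ii}$ ($0\le i\le D$), $\beta_i=b_{i,i+1}$ ($0\le i\le D-1$), $\gamma_i=b_{i,i-1}$ ($1\le i\le D$), $\gamma_0=0$, $\beta_D=0$, and assume that $\alpha_0=0$, $\gamma_1=1$ and $\alpha_i+\beta_i+\gamma_i=\kappa$ for all $0\leq i\leq D$, for some positive number $\kappa$. Let $\theta_0=\kappa>\theta_1>\cdots>\theta_D$ be the (distinct, real) eigenvalues of $B$. \begin{enumerate} \item $(\theta_1+1)(\theta_D+1)\leq -\beta_1$, with equality if and only if $D=2$. \item Assume $D\geq 3$. If $\beta_2+\gamma_3\geq \kappa+1$, then $(\theta_1+1)(\theta_{D-1}+1)(\theta_D+1)\geq -\beta_1(\kappa+1-\beta_2-\gamma_3)$. If $\beta_2+\gamma_3\leq \kappa+1$, then $(\theta_1+1)(\theta_{2}+1)(\theta_D+1)\leq -\beta_1(\kappa+1-\beta_2-\gamma_3)$. Moreover, equality holds in either case if and only if $D=3$. \end{enumerate} *)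

(* Defs.v *)
From HB Require Import structures.
From mathcomp Require Import all_boot all_order all_algebra.

Set Implicit Arguments.
Unset Strict Implicit.
Unset Printing Implicit Defensive.

Import Order.TTheory GRing.Theory Num.Theory.
Local Open Scope ring_scope.

Section Tridiagonal.
Variables (R : rcfType) (D : nat).
Implicit Types (B : 'M[R]_D.+1) (theta : nat -> R).

Definition tridiagonal B :=
  forall i j : 'I_D.+1, (i.+1 < j)%N || (j.+1 < i)%N -> B i j = 0.

Definition nonneg_mx B := forall i j : 'I_D.+1, 0 <= B i j.

(* The rows and columns are numbered 0, ..., D; these functions are only
   meaningful at indices i <= D. *)
Definition diag_entry B (i : nat) : R := B (inord i) (inord i).

Definition super_entry B (i : nat) : R :=
  if (i < D)%N then B (inord i) (inord i.+1) else 0.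

Definition sub_entry B (i : nat) : R :=
  if (0 < i)%N then B (inord i) (inord i.-1) else 0.

(* The values of theta beyond index D are irrelevant. The mathcomp predicate
   [eigenvalue] refers to left (row) eigenvectors, which for a square matrix
   give the same eigenvalues as column eigenvectors. *)
Definition decreasing_eigenvalues B theta :=
  (forall i j : nat, (i < j <= D)%N -> theta j < theta i) /\
  (forall x : R, eigenvalue B x <-> exists2 i : nat, (i <= D)%N & x = theta i).

End Tridiagonal.

(* Main.v *)
(* The partial sums of a row eigenvector of B for an eigenvalue x <> kappa
   vanish at D and satisfy a three-term recurrence, so theta_1 + 1, ...,
   theta_D + 1 are the eigenvalues of the D x D tridiagonal matrix with diagonal
   kappa + 1 - beta_i - gamma_{i+1} and off-diagonal products beta_i gamma_i.
   Its diagonal starts with 0, so its leading 2 x 2 and 3 x 3 minors are -beta_1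
   and -beta_1 (kappa + 1 - beta_2 - gamma_3). The eigenvalues of these leading
   blocks are strictly interlaced by those of any larger leading block, which
   compares the products of the extreme eigenvalues with the minors. *)
Require Import Defs.
From HB Require Import structures.
From mathcomp Require Import all_boot all_order all_algebra.
From mathcomp Require Import polyrcf ring lra zify.

Set Implicit Arguments.
Unset Strict Implicit.
Unset Printing Implicit Defensive.

Import Order.TTheory GRing.Theory Num.Theory.
Local Open Scope ring_scope.

(** * Real-rooted polynomials and interlacing of roots *)

Section Interlacing.
Variable R : rcfType.
Implicit Types (p q : {poly R}) (r s t : nat -> R) (k n i j : nat).

Definition decreasing_upto k r := forall i j, (i < j < k)%N -> r j < r i.

Definition root_product k r : {poly R} := \prod_(i < k) ('X - (r i)%:P).

Lemma decreasing_uptoP k r :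
  (forall i, (i.+1 < k)%N -> r i.+1 < r i) -> decreasing_upto k r.
Proof.
move=> h i j; elim: j => // j IH; rewrite ltnS => /andP[ij jk].
move: ij; rewrite leq_eqVlt => /orP[/eqP->|ij]; first exact: h.
by apply: lt_trans (h _ jk) (IH _); rewrite ij ltnW.
Qed.

Lemma horner_root_product k r x :
  (root_product k r).[x] = \prod_(i < k) (x - r i).
Proof. by rewrite horner_prod; apply: eq_bigr => i _; rewrite !hornerE. Qed.

Lemma root_product_eq k p r : p \is monic -> size p = k.+1 ->
  decreasing_upto k r -> (forall i, (i < k)%N -> root p (r i)) ->
  p = root_product k r.
Proof.
move=> pm sp rdec rp; pose rs := [seq r i | i <- iota 0 k].
rewrite (@all_roots_prod_XsubC _ p rs) ?size_map ?size_iota //.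
- rewrite (monicP pm) scale1r big_map -{1}[k]subn0.
  by rewrite -/(index_iota 0 k) big_mkord.
- by apply/allP=> _ /mapP[i + ->]; rewrite mem_iota; apply: rp.
rewrite uniq_rootsE map_inj_in_uniq ?iota_uniq // => i j.
rewrite !mem_iota !add0n /= => ik jk rij.
by case: (ltngtP i j) => // h;
  [have := rdec i j | have := rdec j i]; rewrite rij ltxx h ?ik ?jk => /(_ isT).
Qed.

(** Equal products have the same root set, and a strictly sorted list is determined by its
    members. *)
Lemma root_product_inj k r s : decreasing_upto k r -> decreasing_upto k s ->
  root_product k r = root_product k s -> forall i, (i < k)%N -> r i = s i.
Proof.
move=> rdec sdec e i ik.
(* The index is reversed so that the list is increasing, as sortedness for [<] requires. *)
pose srt u := [seq u (k.-1 - i)%N | i <- iota 0 k] : seq R.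
have srtS u : decreasing_upto k u -> sorted <%R (srt u).
  move=> udec; rewrite sorted_map.
  apply: (@sub_in_sorted _ (mem (iota 0 k)) ltn); last exact: iota_ltn_sorted.
    by move=> x y; rewrite !mem_iota /= => xk yk xy; apply: udec; lia.
  exact/allP.
have memS u x : (x \in srt u) = root (root_product k u) x.
  rewrite /root horner_root_product; apply/mapP/prodf_eq0.
    case=> j; rewrite mem_iota => /andP[_ jk] ->.
    have jk' : (k.-1 - j < k)%N by lia.
    by exists (Ordinal jk'); rewrite // subr_eq0.
  case=> j _; rewrite subr_eq0 => /eqP ->; exists (k.-1 - j)%N.
    by rewrite mem_iota; have := ltn_ord j; lia.
  by congr u; have := ltn_ord j; lia.
have eq_mem_srt : srt r =i srt s by move=> x; rewrite !memS e.
have := irr_sorted_eq lt_trans ltxx (srtS r rdec) (srtS s sdec) eq_mem_srt.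
move/(congr1 (nth 0 ^~ (k.-1 - i)%N)).
rewrite !(nth_map 0%N) ?size_iota ?nth_iota; try lia.
by have -> : (k.-1 - (0 + (k.-1 - i)) = i)%N by lia.
Qed.

(** Exactly the first [i] factors [x - r j] are negative. *)
Lemma signed_root_product k r x i : (i <= k)%N ->
  (forall j, (j < i)%N -> x < r j) ->
  (forall j, (i <= j < k)%N -> r j < x) ->
  0 < (-1) ^+ i * (root_product k r).[x].
Proof.
rewrite horner_root_product; elim: k i => [|k IH] i.
  by rewrite leqn0 => /eqP -> _ _; rewrite big_ord0 mulr1.
rewrite leq_eqVlt => /orP[/eqP-> lt_x _|ik lt_x gt_x].
  rewrite big_ord_recr /= exprS mulrA mulN1r mulNr mulNr -mulrN.
  rewrite mulr_gt0 // ?opprB ?subr_gt0 ?lt_x //.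
  by apply: IH => // j; [move=> jk; apply: lt_x; lia | lia].
rewrite big_ord_recr /= mulrA mulr_gt0 ?subr_gt0 ?gt_x ?ltnSn ?andbT //.
by apply: IH => // j ijk; apply: gt_x; lia.
Qed.

Lemma monic_sign_at_infty p n : p \is monic -> size p = n.+1 ->
  exists b, forall x, b <= x -> 0 < p.[x] /\ 0 < (-1) ^+ n * p.[- x].
Proof.
move=> pm sp; have lp : 0 < lead_coef p by rewrite (monicP pm) ltr01.
(* The behaviour of [p] at minus infinity is that of [q] at plus infinity, and [q] again has
   positive leading coefficient. *)
pose q := (-1) ^+ n *: (p \Po - 'X).
have lq : 0 < lead_coef q.
  rewrite lead_coefZ lead_coef_comp ?size_polyN ?size_polyX //.
  rewrite (monicP pm) sp lead_coefN lead_coefX mul1r -exprMn mulrNN mulr1.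
  by rewrite expr1n.
have [b1 h1] := poly_pinfty_gt_lc lp; have [b2 h2] := poly_pinfty_gt_lc lq.
exists (Num.max b1 b2) => x; rewrite ge_max => /andP[/h1 x1 /h2].
rewrite !hornerE horner_comp !hornerE => x2.
by split; [exact: lt_le_trans x1 | exact: lt_le_trans x2].
Qed.

(** The values of [p] at consecutive points have opposite signs, so the intermediate value theorem
    applies in each gap. *)
Lemma alternating_signs_roots k p t : decreasing_upto k.+1 t ->
  (forall i, (i <= k)%N -> 0 < (-1) ^+ i * p.[t i]) ->
  exists s, forall i, (i < k)%N -> root p (s i) /\ t i.+1 < s i < t i.
Proof.
move=> tdec tsgn.
have /fin_all_exists[f hf] (i : 'I_k) :
    exists x, root p x /\ t i.+1 < x < t i.
  have ti : t i.+1 < t i by apply: tdec; have := ltn_ord i; lia.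
  have pt : p.[t i.+1] * p.[t i] < 0.
    have := mulr_gt0 (tsgn i (ltnW (ltn_ord i))) (tsgn i.+1 (ltn_ord i)).
    rewrite mulrACA -exprD addnS exprS addnn -mul2n exprM sqrrN !expr1n mulr1.
    by rewrite mulN1r oppr_gt0 mulrC.
  have [x xi rx] := poly_ivtoo (ltW ti) pt.
  by exists x; move: xi; rewrite in_itv.
exists (fun i => if insub i is Some j then f j else 0) => i ik.
by rewrite insubT; apply: (hf (Ordinal ik)).
Qed.

(* Cauchy interlacing, one step: the sign pattern of [q] at the roots of [p]
   forces a root of [q] in each gap and in both unbounded ends. *)
Lemma interlacing_step k q r : decreasing_upto k r ->
  q \is monic -> size q = k.+2 ->
  (forall i, (i < k)%N -> (-1) ^+ i * q.[r i] < 0) ->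
  exists s, [/\ decreasing_upto k.+1 s, q = root_product k.+1 s,
    forall i, (i < k)%N -> s i.+1 < r i < s i &
    forall i, (i <= k)%N -> 0 < (-1) ^+ i * (root_product k r).[s i]].
Proof.
move=> rdec qm sq qr; have [b hb] := monic_sign_at_infty qm sq.
pose M := `|b| + 1 + \sum_(i < k) `|r i|.
have sum0 : 0 <= \sum_(i < k) `|r i| by apply: sumr_ge0.
have bM : b <= M by have := ler_norm b; rewrite /M; lra.
have rM i : (i < k)%N -> `|r i| < M.
  move=> ik; rewrite /M (bigD1 (Ordinal ik)) //=.
  have : 0 <= \sum_(j < k | j != Ordinal ik) `|r j| by apply: sumr_ge0.
  by have := normr_ge0 b; lra.
(* The sample points are [M], then the roots of [p], then [- M]; [M] exceeds every [|r i|] and lies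
   where the signs at infinity hold. *)
pose t i := if i is i'.+1 then if (i' < k)%N then r i' else - M else M.
have tdec : decreasing_upto k.+2 t.
  apply: decreasing_uptoP => -[|i] /=; rewrite !ltnS => ik.
    case: ifP => [/rM|_]; first by rewrite ltr_norml => /andP[].
    by rewrite /M; have := normr_ge0 b; lra.
  rewrite ik; case: ifP => [ik'|_]; first by apply: rdec; lia.
  by have := rM _ ik; rewrite ltr_norml => /andP[].
have tsgn i : (i <= k.+1)%N -> 0 < (-1) ^+ i * q.[t i].
  case: i => [|i] /=; first by rewrite mul1r; case: (hb _ bM).
  rewrite ltnS leq_eqVlt => /orP[/eqP ->|ik].
    by rewrite ltnn; case: (hb _ bM).
  by rewrite ik exprS mulN1r mulNr oppr_gt0 qr.
have [s hs] := alternating_signs_roots tdec tsgn.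
have inter i : (i < k)%N -> s i.+1 < r i < s i.
  move=> ik; have [_ /andP[+ _]] := hs i (ltnW ik).
  have [_ /andP[_ +]] := hs i.+1 ik.
  by rewrite /= ik => -> ->.
have sdec : decreasing_upto k.+1 s.
  apply: decreasing_uptoP => i; rewrite ltnS => /inter/andP[h1 h2].
  exact: lt_trans h1 h2.
exists s; split => //.
  by apply: root_product_eq => // i ik; case: (hs i ik).
move=> i ik; apply: signed_root_product => // j.
  move=> ji; have jk : (j < k)%N by lia.
  have /andP[sr _] := inter j jk; apply: le_lt_trans sr.
  move: ji; rewrite leq_eqVlt => /orP[/eqP -> //|ji].
  by apply/ltW/sdec; lia.
move=> /andP[ij jk]; have /andP[_ rs] := inter j jk; apply: lt_le_trans rs _.
move: ij; rewrite leq_eqVlt => /orP[/eqP -> //|ij].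
by apply/ltW/sdec; lia.
Qed.

End Interlacing.

(** * Characteristic polynomials of leading tridiagonal blocks *)

Section Jacobi.
Variable R : rcfType.
Implicit Types (a c r : nat -> R) (k m n : nat).

(* The characteristic polynomial of the leading n x n block of a tridiagonal
   matrix with diagonal [a] and with [c i] the product of its two entries
   (i - 1, i) and (i, i - 1). *)
Fixpoint jacobi_poly a c n : {poly R} :=
  if n is n'.+1 then
    ('X - (a n')%:P) * jacobi_poly a c n'
    - (if n' is n''.+1 then c n' *: jacobi_poly a c n'' else 0)
  else 1.

Lemma jacobi_polySS a c n : jacobi_poly a c n.+2 =
  ('X - (a n.+1)%:P) * jacobi_poly a c n.+1 - c n.+1 *: jacobi_poly a c n.
Proof. by []. Qed.

Lemma size_monic_jacobi_poly a c n :
  size (jacobi_poly a c n) = n.+1 /\ jacobi_poly a c n \is monic.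
Proof.
elim/ltn_ind: n => -[|[|n]] IH.
- by rewrite size_poly1 monic1.
- by rewrite /= subr0 mulr1 size_XsubC monicXsubC.
have [s1 m1] := IH n.+1 (ltnSn _); have [s0 _] := IH n (ltnW (ltnSn _)).
rewrite jacobi_polySS.
set p := _ * _; set q := c _ *: _.
have pm : p \is monic by rewrite monicMl ?monicXsubC.
have sp : size p = n.+3 by rewrite size_Mmonic ?polyXsubC_eq0 // size_XsubC s1.
have sq : (size (- q)%R < size p)%N.
  by rewrite size_polyN sp (leq_ltn_trans (size_scale_leq _ _)) // s0; lia.
by rewrite size_polyDl // monicE lead_coefDl // -monicE.
Qed.

(* The last clause is the Sturm sign condition that drives the induction. *)
Definition jacobi_roots a c k r := [/\ decreasing_upto k r,
  jacobi_poly a c k = root_product k r &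
  forall i, (i < k)%N -> 0 < (-1) ^+ i * (jacobi_poly a c k.-1).[r i]].

Lemma jacobi_roots0 a c : exists r, jacobi_roots a c 0 r.
Proof.
by exists (fun=> 0); split=> [i j||//]; [lia | rewrite /root_product big_ord0].
Qed.

(** At a root of the [k]-th polynomial the recurrence leaves only [- c k] times the previous
    polynomial, whose sign there is known. *)
Lemma jacobi_rootsS a c k r : ((0 < k)%N -> 0 < c k) -> jacobi_roots a c k r ->
  exists2 s, jacobi_roots a c k.+1 s &
    forall i, (i < k)%N -> s i.+1 < r i < s i.
Proof.
move=> ck [rdec rprod rsgn].
have [sq mq] := size_monic_jacobi_poly a c k.+1.
have qr i : (i < k)%N -> (-1) ^+ i * (jacobi_poly a c k.+1).[r i] < 0.
  case: k rdec rprod rsgn ck {sq mq} => // k rdec rprod rsgn ck ik.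
  have ri0 : (jacobi_poly a c k.+1).[r i] = 0.
    rewrite rprod horner_root_product; apply/eqP/prodf_eq0.
    by exists (Ordinal ik); rewrite //= subrr.
  rewrite jacobi_polySS hornerD hornerN hornerZ hornerM ri0 mulr0 add0r.
  by rewrite mulrN mulrCA oppr_lt0 mulr_gt0 ?ck ?rsgn.
have [s [sdec sprod inter ssgn]] := interlacing_step rdec mq sq qr.
by exists s => //; split => // i ik; rewrite /= rprod ssgn.
Qed.

(** Each enlargement of the block raises the root of a given rank from the top and lowers the root
    of a given rank from the bottom; the shift [k - m] converts the second rank into an index. *)
Lemma jacobi_roots_interlacing a c m k r :
  (forall i, (0 < i < k)%N -> 0 < c i) -> (m < k)%N -> jacobi_roots a c m r ->
  exists2 s, jacobi_roots a c k s &
    forall i, (i < m)%N -> s (k - m + i)%N < r i < s i.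
Proof.
move=> + + hr; elim: k => // k IH cpos; rewrite ltnS leq_eqVlt.
case/orP => [/eqP mk|mk].
  subst m; have [|s hs inter] := jacobi_rootsS _ hr.
    by move=> k0; apply: cpos; lia.
  by exists s => // i ik; rewrite subSnn; apply: inter.
have [|s hs inter] := IH _ mk; first by move=> i ik; apply: cpos; lia.
have [|u hu uinter] := jacobi_rootsS _ hs; first by move=> k0; apply: cpos; lia.
exists u => // i im; have /andP[h1 h2] := inter i im.
have /andP[_ h3] := uinter i ltac:(lia).
have /andP[h4 _] := uinter (k - m + i)%N ltac:(lia).
by rewrite subSn ?(ltnW mk) // addSn (lt_trans h4 h1) (lt_trans h2 h3).
Qed.

End Jacobi.

(** * From row eigenvectors to the reduced tridiagonal matrix *)

Section RowEigenvector.
Variable R : rcfType.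

(** Extending [u] by zero beyond [D] gives the last equation the same form as the others. *)
Lemma tridiagonal_row_eigenvector D (B : 'M[R]_D.+1) (v : 'rV_D.+1) x
    (u := fun i => if (i <= D)%N then v 0 (inord i) else 0) :
  tridiagonal B -> v *m B = x *: v -> forall i, (i <= D)%N ->
  x * u i = (if i is i'.+1 then u i' * super_entry B i' else 0)
    + u i * diag_entry B i + u i.+1 * sub_entry B i.+1.
Proof.
move=> tri vB i iD.
have -> : x * u i = \sum_(0 <= j < D.+1) u j * B (inord j) (inord i).
  rewrite /u iD; move/matrixP/(_ 0 (inord i)): vB; rewrite !mxE => <-.
  rewrite big_mkord; apply: eq_bigr => j _.
  by rewrite -ltnS ltn_ord inord_val.
(* [L], [M] and [U] isolate the terms just before, at and just after [i], so each sum has at most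
   one nonzero term. *)
pose L j := if j.+1 == i then u j * super_entry B j else 0.
pose M j := if j == i then u j * diag_entry B j else 0.
pose U j := if j == i.+1 then u j * sub_entry B j else 0.
rewrite (@eq_big_nat _ _ _ _ _ _ (fun j => L j + M j + U j)); last first.
  move=> j /andP[_ jD]; rewrite /L /M /U /super_entry /diag_entry /sub_entry.
  have [e|ji1] := eqVneq j.+1 i.
    by subst i; rewrite !ltn_eqF // !addr0 (_ : (j < D)%N).
  have [->|ji] := eqVneq j i.
    by rewrite ltn_eqF // addr0 add0r.
  have [->|ij] := eqVneq j i.+1; first by rewrite !add0r.
  by rewrite tri ?mulr0 ?addr0 // !inordK //; lia.
rewrite !big_split /=; congr (_ + _ + _).
- rewrite /L; case: i {L M U} iD => [|i] iD.
    by rewrite big1.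
  rewrite -big_mkcond /= (eq_bigl (fun j => j == i)) // big_nat1_eq.
  by rewrite leq0n ltnS (ltnW iD).
- by rewrite /M -big_mkcond big_nat1_eq /= ltnS iD.
rewrite /U -big_mkcond big_nat1_eq /= ltnS.
by case: (ltnP i D) => // Di; rewrite /u ltnNge Di mul0r.
Qed.

(* Summing the eigenvector equations turns the constant row sums into a
   three-term recurrence for the partial sums of a row eigenvector. *)
Lemma partial_sum_recurrence (alpha beta gamma u : nat -> R) (kappa x : R) D :
  (forall i, (i <= D)%N -> alpha i + beta i + gamma i = kappa) ->
  gamma 0%N = 0 ->
  (forall i, (i <= D)%N ->
    x * u i = (if i is i'.+1 then u i' * beta i' else 0)
      + u i * alpha i + u i.+1 * gamma i.+1) ->
  forall i, (i <= D)%N ->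
    (x - kappa) * \sum_(j < i.+1) u j = gamma i.+1 * u i.+1 - beta i * u i.
Proof.
move=> rowsum gamma0 ueq; elim=> [|i IH] iD.
  have := ueq 0%N iD; rewrite big_ord1 -(rowsum 0%N) // gamma0 mulrBl => ->.
  by ring.
rewrite big_ord_recr mulrDr (IH (ltnW iD)) /= mulrBl ueq // -(rowsum _ iD).
by ring.
Qed.

Lemma eigenvalue_jacobi_poly D (B : 'M[R]_D.+1) (alpha beta gamma : nat -> R)
    (kappa x : R) (a := fun i => kappa + 1 - beta i - gamma i.+1)
    (c := fun i => beta i * gamma i) :
  tridiagonal B ->
  (forall i, (i <= D)%N -> alpha i = diag_entry B i) ->
  (forall i, (i <= D)%N -> beta i = super_entry B i) ->
  (forall i, (i <= D)%N -> gamma i = sub_entry B i) ->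
  (forall i, (0 < i <= D)%N -> gamma i != 0) ->
  (forall i, (i <= D)%N -> alpha i + beta i + gamma i = kappa) ->
  eigenvalue B x -> x != kappa -> root (jacobi_poly a c D) (x + 1).
Proof.
move=> tri halpha hbeta hgamma gamma_neq0 rowsum /eigenvalueP[v vB v_neq0] xk.
pose u i := if (i <= D)%N then v 0 (inord i) else 0.
pose S i := \sum_(j < i.+1) u j.
have SS i : S i.+1 = S i + u i.+1 by rewrite /S big_ord_recr.
have S0 : S 0%N = u 0%N by rewrite /S big_ord1.
have gamma0 : gamma 0%N = 0 by rewrite hgamma.
have betaD : beta D = 0 by rewrite hbeta // /super_entry ltnn.
have uD1 : u D.+1 = 0 by rewrite /u ltnn.
have Srec i : (i <= D)%N ->
    (x - kappa) * S i = gamma i.+1 * u i.+1 - beta i * u i.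
  apply: (partial_sum_recurrence rowsum gamma0) => {}i iD.
  rewrite (tridiagonal_row_eigenvector tri vB iD) -/(u _) -/(u _) -halpha //.
  congr (_ + _ + _); first by case: i iD => // i iD; rewrite hbeta // ltnW.
  case: (ltnP i D) => iD'; first by rewrite hgamma.
  by have -> : i = D by [lia]; rewrite -/(u _) uD1 !mul0r.
(* At [D] the right side of the recurrence vanishes, while [x - kappa] does not. *)
have SD : S D = 0.
  have := Srec D (leqnn D); rewrite uD1 betaD mulr0 mul0r subr0 => /eqP.
  by rewrite mulf_eq0 subr_eq0 (negPf xk) => /eqP.
(* Scaling the partial sums by products of [gamma] turns their recurrence into that of the monic
   polynomials. *)
have PS i : (i <= D)%N -> (jacobi_poly a c i).[x + 1] * u 0%N =
    \prod_(j < i) gamma j.+1 * S i.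
  elim/ltn_ind: i => -[|[|i]] IH iD.
  - by rewrite big_ord0 hornerC S0.
  - have := Srec 0%N (ltnW iD).
    rewrite SS S0 big_ord1 !hornerE /a => /eqP; rewrite -subr_eq0 => /eqP e.
    by apply: subr0_eq; rewrite -[RHS]e; ring.
  rewrite jacobi_polySS hornerD hornerN hornerZ hornerM mulrBl -!mulrA.
  rewrite !IH //; try lia.
  rewrite !SS !big_ord_recr !hornerE /= /a /c.
  have /eqP := Srec i.+1 (ltnW iD); rewrite SS -subr_eq0 => /eqP e.
  (* The difference of the two sides is a product of [gamma] values times the left side of [e]. *)
  apply: subr0_eq.
  rewrite -[RHS](mulr0 (\prod_(j < i) gamma j.+1 * gamma i.+1)) -[in RHS]e.
  by ring.
(* If [u 0] were zero, [PS] would kill all partial sums, hence the whole eigenvector. *)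
have u0_neq0 : u 0%N != 0.
  apply: contra v_neq0 => /eqP u0.
  have Seq0 i : (i <= D)%N -> S i = 0.
    move=> iD; have := PS i iD; rewrite u0 mulr0 => /esym/eqP.
    rewrite mulf_eq0 => /orP[|/eqP //].
    case/prodf_eq0 => j _; apply: contraTeq => _; apply: gamma_neq0.
    by have := ltn_ord j; lia.
  apply/eqP/rowP => j; rewrite !mxE -(inord_val j).
  have jD : (j <= D)%N by rewrite -ltnS.
  suff : u j = 0 by rewrite /u jD.
  case: (nat_of_ord j) jD => // i iD.
  by have := SS i; rewrite !Seq0 ?(ltnW iD) // add0r.
have /eqP := PS D (leqnn D).
by rewrite SD mulr0 mulf_eq0 (negPf u0_neq0) orbF.
Qed.

End RowEigenvector.

(** * Comparison of extreme eigenvalues with leading minors *)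

Theorem theorem2p2 (R : rcfType) (D : nat) (hD : (2 <= D)%N)
    (B : 'M[R]_D.+1) (alpha beta gamma : nat -> R) (kappa : R)
    (theta : nat -> R)
    (hnonneg : nonneg_mx B)
    (htri : tridiagonal B)
    (halpha : forall i, (i <= D)%N -> alpha i = diag_entry B i)
    (hbeta : forall i, (i <= D)%N -> beta i = super_entry B i)
    (hgamma : forall i, (i <= D)%N -> gamma i = sub_entry B i)
    (hbeta_gt0 : forall i, (i < D)%N -> 0 < beta i)
    (hgamma_gt0 : forall i, (0 < i <= D)%N -> 0 < gamma i)
    (halpha0 : alpha 0%N = 0)
    (hgamma1 : gamma 1%N = 1)
    (hkappa : 0 < kappa)
    (hsum : forall i, (i <= D)%N -> alpha i + beta i + gamma i = kappa)
    (htheta : decreasing_eigenvalues B theta)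
    (htheta0 : theta 0%N = kappa) :
  ((theta 1%N + 1) * (theta D + 1) <= - beta 1%N /\
   ((theta 1%N + 1) * (theta D + 1) = - beta 1%N <-> D = 2%N)) /\
  ((3 <= D)%N ->
   (kappa + 1 <= beta 2%N + gamma 3%N ->
    - beta 1%N * (kappa + 1 - beta 2%N - gamma 3%N)
      <= (theta 1%N + 1) * (theta D.-1 + 1) * (theta D + 1) /\
    ((theta 1%N + 1) * (theta D.-1 + 1) * (theta D + 1)
      = - beta 1%N * (kappa + 1 - beta 2%N - gamma 3%N) <-> D = 3%N)) /\
   (beta 2%N + gamma 3%N <= kappa + 1 ->
    (theta 1%N + 1) * (theta 2%N + 1) * (theta D + 1)
      <= - beta 1%N * (kappa + 1 - beta 2%N - gamma 3%N) /\
    ((theta 1%N + 1) * (theta 2%N + 1) * (theta D + 1)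
      = - beta 1%N * (kappa + 1 - beta 2%N - gamma 3%N) <-> D = 3%N))).
Proof.
have gamma0 : gamma 0%N = 0 by rewrite hgamma.
have beta0 : beta 0%N = kappa.
  by rewrite -(hsum 0%N) // halpha0 gamma0 addr0 add0r.
have beta1_gt0 := hbeta_gt0 1%N hD.
pose a i := kappa + 1 - beta i - gamma i.+1.
pose c i := beta i * gamma i.
have c_gt0 i : (0 < i < D)%N -> 0 < c i.
  by case/andP=> i0 iD; rewrite mulr_gt0 ?hbeta_gt0 ?hgamma_gt0 ?i0 ?(ltnW iD).
have [thetadec thetaeig] := htheta.
(* The shift of index drops [theta 0 = kappa]; the remaining [D] distinct values exhaust the roots
   of a polynomial of degree [D]. *)
pose mu i := theta i.+1 + 1.
have mudec : decreasing_upto D mu.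
  by move=> i j /andP[ij jD]; rewrite ltrD2r thetadec // ltnS ij.
have PD : jacobi_poly a c D = root_product D mu.
  have [sP mP] := size_monic_jacobi_poly a c D.
  apply: root_product_eq => // i iD.
  apply: (eigenvalue_jacobi_poly htri halpha hbeta hgamma _ hsum).
  - by move=> j jD; rewrite gt_eqF ?hgamma_gt0.
  - by apply/thetaeig; exists i.+1.
  by rewrite -htheta0 lt_eqF ?thetadec.
have mu_interlacing m r : (m < D)%N -> jacobi_roots a c m r ->
    forall i, (i < m)%N -> mu (D - m + i)%N < r i < mu i.
  move=> mD /(jacobi_roots_interlacing c_gt0 mD)[s [sdec sprod _] inter] i im.
  have mus := root_product_inj mudec sdec (etrans (esym PD) sprod).
  by rewrite !mus; [exact: inter | lia | lia].
have a0 : a 0%N = 0 by rewrite /a beta0 hgamma1; ring.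
have P2 : (jacobi_poly a c 2).[0] = - beta 1%N.
  by rewrite /= a0 /c hgamma1 !hornerE; ring.
have P3 : (jacobi_poly a c 3).[0]
    = beta 1%N * (kappa + 1 - beta 2%N - gamma 3%N).
  rewrite jacobi_polySS hornerD hornerN hornerZ hornerM P2 /= a0 /a !hornerE.
  by ring.
have [r0 hr0] := jacobi_roots0 a c.
have [//|r1 hr1 _] := jacobi_rootsS _ hr0.
have [_|r2 hr2 _] := jacobi_rootsS _ hr1; first exact: c_gt0.
have [r2dec P2r _] := hr2.
have r20 : r2 0%N * r2 1%N = - beta 1%N.
  by rewrite -P2 P2r horner_root_product 2!big_ord_recl big_ord0 /=; ring.
(* The product of these two roots is negative, so they lie on either side of 0. *)
have r2lt : r2 1%N < r2 0%N by apply: r2dec.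
have r2_gt0 : 0 < r2 0%N by nra.
have r2_lt0 : r2 1%N < 0 by nra.
rewrite -/(mu 0%N) -/(mu 1%N).
have thetaD k : (k < D)%N -> theta (D - k)%N + 1 = mu (D - k.+1)%N.
  by move=> kD; rewrite /mu -subSn // subSS.
have -> : theta D + 1 = mu (D - 1)%N by rewrite -thetaD ?subn0; [|lia].
split.
  (* For [D = 2] the block is the whole reduced matrix; beyond that, strict interlacing pushes both
     extreme roots away from 0. *)
  have [D2|D3] : D = 2%N \/ (2 < D)%N by lia.
    have -> : mu 0%N * mu (D - 1)%N = - beta 1%N.
      rewrite -P2 -D2 PD horner_root_product D2 2!big_ord_recl big_ord0 /=.
      by rewrite /bump /=; ring.
    by rewrite lexx.
  have /andP[_ mu0] := mu_interlacing 2%N r2 D3 hr2 0%N isT.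
  have /andP[] := mu_interlacing 2%N r2 D3 hr2 1%N isT.
  have -> : (D - 2 + 1 = D - 1)%N by lia.
  move=> mu1 _.
  have lt_beta1 : mu 0%N * mu (D - 1)%N < - beta 1%N by nra.
  split; first exact: ltW.
  by split=> e; [move: lt_beta1; rewrite e ltxx | rewrite e in D3].
move=> D3.
have -> : theta D.-1 + 1 = mu (D - 2)%N by rewrite -subn1 thetaD //; lia.
set k := kappa + 1 - beta 2%N - gamma 3%N in P3 *.
have [D3'|D4] : D = 3%N \/ (3 < D)%N by lia.
  have e : mu 0%N * mu 1%N * mu 2%N = - beta 1%N * k.
    have := P3; rewrite -{1}D3' PD horner_root_product D3' !big_ord_recl.
    by rewrite big_ord0 /= /bump /= => h; rewrite mulNr -h; ring.
  by rewrite D3' e lexx.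
have [_|r3 hr3 r3inter] := jacobi_rootsS _ hr2; first exact: c_gt0.
have [r3dec P3r _] := hr3.
have r30 : r3 0%N * r3 1%N * r3 2%N = - beta 1%N * k.
  rewrite mulNr -P3 P3r horner_root_product !big_ord_recl big_ord0 /=.
  by rewrite /bump /=; ring.
(* The outer roots of the 3 x 3 block lie beyond those of the 2 x 2 block, so they inherit their
   signs. *)
have /andP[_ r3_gt0] := r3inter 0%N isT.
have /andP[r3_lt0 _] := r3inter 1%N isT.
have {}r3_gt0 : 0 < r3 0%N by exact: lt_trans r3_gt0.
have {}r3_lt0 : r3 2%N < 0 by exact: lt_trans r2_lt0.
have /andP[_ mu0] := mu_interlacing 3%N r3 D4 hr3 0%N isT.
have /andP[mu2 mu1] := mu_interlacing 3%N r3 D4 hr3 1%N isT.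
have /andP[mu3 _] := mu_interlacing 3%N r3 D4 hr3 2%N isT.
rewrite -subnA // in mu2; rewrite -subnA // in mu3.
split=> hk.
  have k_le0 : k <= 0 by rewrite /k; lra.
  have lt_k : - beta 1%N * k < mu 0%N * mu (D - 2)%N * mu (D - 1)%N.
    (* The outer roots have opposite signs, so [r30] gives the middle root the sign of [k]. *)
    have r31 : r3 1%N <= 0.
      rewrite -(pmulr_rle0 _ r3_gt0) -(nmulr_lge0 _ r3_lt0) r30 mulNr oppr_ge0.
      by rewrite pmulr_rle0.
    (* Negating the last two factors makes all factors nonnegative, so the strict inequalities
       multiply. *)
    rewrite -r30 -!mulrA -[r3 1%N * _]mulrNN -[mu (D - 2)%N * _]mulrNN.
    have r32 : 0 <= - r3 2%N by rewrite oppr_ge0 ltW.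
    by rewrite !ltr_pM ?ltrN2 ?mulr_ge0 ?oppr_ge0 // ltW.
  split; first exact: ltW.
  by split=> e; [move: lt_k; rewrite e ltxx | rewrite e in D4].
have k_ge0 : 0 <= k by rewrite /k; lra.
have lt_k : mu 0%N * mu 1%N * mu (D - 1)%N < - beta 1%N * k.
  have r31 : 0 <= r3 1%N.
    rewrite -(pmulr_rge0 _ r3_gt0) -(nmulr_lle0 _ r3_lt0) r30 mulNr oppr_le0.
    by rewrite pmulr_rge0.
  have r32 : 0 <= - r3 2%N by rewrite oppr_ge0 ltW.
  (* Here only the last factor is negative; negating both sides makes every factor nonnegative. *)
  rewrite -r30 -ltrN2 -!mulrN.
  by rewrite !ltr_pM ?ltrN2 ?mulr_ge0 // ltW.
split; first exact: ltW.
by split=> e; [move: lt_k; rewrite e ltxx | rewrite e in D4].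
Qed.
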